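(* Let $\beta \ge 2$ be an integer. For each integer $a$ with $1 \le a < \beta$, let $A_{\beta,a}$ be the deterministic finite automaton defined in the context. Then: (i) For every $1 \le a < \beta$: if the string $(x_1,y_1)(x_2,y_2)\cdots(x_n,y_n)$ is accepted by $A_{\beta,a}$ for some $n \ge 1$, then $a$ and the integer $b$ whose base-$\beta$ digits, from most to least significant, are $x_1 x_2 \cdots x_n y_n \cdots y_2 y_1$ form a reversed sum-product pair $(a,b)$ for the base $\beta$. (ii) For every $1 \le a < \beta$: if the string $(x_1,y_1)(x_2,y_2)\cdots(x_n,y_n)(z)$ is accepted by $A_{\beta,a}$ for some $n \ge 0$, then $a$ and the integer $b$ whose base-$\beta$ digits, from most to least significant, are $x_1x_2\cdots x_n z y_n \cdots y_2 y_1$ form a reversed sum-product pair $(a,b)$ for the base $\beta$. (iii) Conversely, every reversed sum-product pair arises in this way: if $a \le b$ is a reversed sum-product pair for the base $\beta$, then $a < \beta$ and $b$ is obtained from some string accepted by $A_{\beta,a}$ as in (i) or (ii).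
   Context: A base-$\beta$ representation of a positive integer is canonical if it has no leading zero. A pair of positive integers $a \le b$ is a reversed sum-product pair for the base $\beta$ if the canonical base-$\beta$ representations of $a+b$ and $ab$ are the reverse of each other as digit strings (in particular they have the same number of digits). A deterministic finite automaton (DFA) here is a finite directed graph with one vertex designated as the initial state, a set of vertices designated as accepting states, and edges (transitions) labeled by letters of an alphabet, with at most one edge with a given label out of each state. A string of letters is accepted if it is the sequence of labels along a directed path from the initial state to an accepting state. Definition of $A_{\beta,a}$ for $\beta \ge 2$ and $1 \le a < \beta$. The alphabet consists of the pairs $(x,y)$ with $0 \le x,y < \beta$ and the singletons $(x)$ with $0 \le x < \beta$. The states are: an initial state $s_i$; an ''odd state'' $s_o$; and a ''carry state'' $s_{\lambda,\rho}$ for each pair of integers $0 \le \lambda,\rho < a$. The accepting states are $s_o$ and all $s_{\lambda,\lambda}$ with $0 \le \lambda < a$. The transitions are: - For each quadruple of integers $(b_r,b_0,\lambda,\rho)$ with $0 < b_r < \beta$, $0 < b_0 < \beta - a$, $0 \le \lambda,\rho < a$ satisfying $$a + b_0 = a b_r + \lambda, \qquad a b_0 = b_r + \rho\beta,$$ a transition from $s_i$ to $s_{\lambda,\rho}$ with label $(b_r,b_0)$. - For each carry state $s_{\lambda,\rho}$ and each quadruple of integers $(x',y',\lambda',\rho')$ with $0 \le x',y' < \beta$, $0 \le \lambda',\rho' < a$ satisfying $$a x' + \lambda' = y' + \lambda\beta, \qquad a y' + \rho = x' + \rho'\beta,$$ a transition from $s_{\lambda,\rho}$ to $s_{\lambda',\rho'}$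 with label $(x',y')$; and if moreover $x'=y'$, also a transition from $s_{\lambda,\rho}$ to $s_o$ with label $(x')$. - If $\beta \ge 5$ and $a = 2$, a transition from $s_i$ to $s_o$ with label $(2)$. - If $\beta \ge 3$ and $a = \beta-1$, a transition from $s_i$ to $s_o$ with label $(\beta-1)$. *)

(* Defs.v *)
From HB Require Import structures.
From mathcomp Require Import all_boot.
From mathcomp Require Import zify.

Set Implicit Arguments.
Unset Strict Implicit.
Unset Printing Implicit Defensive.

(* Digit strings are written from most to least significant digit. *)
Definition of_digits (beta : nat) (ds : seq nat) : nat :=
  foldl (fun n d => n * beta + d) 0 ds.

(* [head 0 ds != 0] also excludes the empty string. *)
Definition canonical_rep (beta n : nat) (ds : seq nat) : Prop :=
  [/\ all (fun d => d < beta) ds, head 0 ds != 0 & of_digits beta ds = n].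

Definition reversed_sum_product (beta a b : nat) : Prop :=
  [/\ 0 < a, 0 < b, a <= b &
      exists s p : seq nat,
        [/\ canonical_rep beta (a + b) s, canonical_rep beta (a * b) p
          & p = rev s]].

Record dfa (L : finType) := Dfa {
  dfa_state : finType;
  dfa_init : dfa_state;
  dfa_accepting : {set dfa_state};
  dfa_edge : dfa_state -> L -> dfa_state -> bool;
  dfa_edge_det : forall s l t t',
    dfa_edge s l t -> dfa_edge s l t' -> t = t' }.

Fixpoint labelled_path (L : finType) (M : dfa L)
    (s : dfa_state M) (w : seq L) (t : dfa_state M) : Prop :=
  if w is l :: w' then exists2 s', dfa_edge s l s' & labelled_path s' w' t
  else s = t.

Definition accepted (L : finType) (M : dfa L) (w : seq L) : Prop :=
  exists2 t, t \in dfa_accepting M & labelled_path (dfa_init M) w t.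

Section Automaton.

Variables beta a : nat.

(* [inl (x, y)] is the letter (x,y) and [inr z] is the letter (z). *)
Definition letter : finType := ('I_beta * 'I_beta + 'I_beta)%type.

Inductive state := Init | Odd | Carry of 'I_a & 'I_a.

Definition state_encode (s : state) : option (option ('I_a * 'I_a)) :=
  match s with
  | Init => None
  | Odd => Some None
  | Carry lambda rho => Some (Some (lambda, rho))
  end.

Definition state_decode (o : option (option ('I_a * 'I_a))) : state :=
  match o with
  | None => Init
  | Some None => Odd
  | Some (Some (lambda, rho)) => Carry lambda rho
  end.

Lemma state_encodeK : cancel state_encode state_decode.
Proof. by case. Qed.

HB.instance Definition _ := Finite.copy state (can_type state_encodeK).

Definition accepting_state (s : state) : bool :=
  match s with
  | Init => false
  | Odd => true
  | Carry lambda rho => lambda == rho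
  end.

Definition start_step (br b0 lambda rho : nat) : bool :=
  [&& 0 < br, 0 < b0, b0 < beta - a,
      a + b0 == a * br + lambda & a * b0 == br + rho * beta].

Definition carry_step (lambda rho x' y' lambda' rho' : nat) : bool :=
  (a * x' + lambda' == y' + lambda * beta) &&
  (a * y' + rho == x' + rho' * beta).

Definition edge (s : state) (l : letter) (t : state) : bool :=
  match s, l, t with
  | Init, inl (br, b0), Carry lambda rho => start_step br b0 lambda rho
  | Carry lambda rho, inl (x', y'), Carry lambda' rho' =>
      carry_step lambda rho x' y' lambda' rho'
  | Carry lambda rho, inr x', Odd =>
      [exists lambda' : 'I_a, exists rho' : 'I_a,
         carry_step lambda rho x' x' lambda' rho']
  | Init, inr z, Odd =>
      [&& 5 <= beta, a == 2 & z == 2 :> nat] ||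
      [&& 3 <= beta, a == beta - 1 & z == beta - 1 :> nat]
  | _, _, _ => false
  end.

Lemma edge_det s l t t' : edge s l t -> edge s l t' -> t = t'.
Proof.
case: s l t t' => [||lam rho] [[x y]|z] [||lam1 rho1] [||lam2 rho2] //=.
  move=> /and5P[_ _ _ /eqP e1 /eqP e2] /and5P[_ _ _ /eqP e3 /eqP e4].
  have beta_gt0 : 0 < beta by apply: leq_ltn_trans (ltn_ord x).
  congr Carry; apply: val_inj => /=; first lia.
  by apply/eqP; rewrite -(eqn_pmul2r beta_gt0); apply/eqP; lia.
move=> /andP[/eqP e1 /eqP e2] /andP[/eqP e3 /eqP e4].
have beta_gt0 : 0 < beta by apply: leq_ltn_trans (ltn_ord x).
congr Carry; apply: val_inj => /=; first lia.
by apply/eqP; rewrite -(eqn_pmul2r beta_gt0); apply/eqP; lia.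
Qed.

Definition automaton : dfa letter :=
  @Dfa letter state Init [set s | accepting_state s] edge edge_det.

End Automaton.

(* (x_1,y_1)...(x_n,y_n) *)
Definition even_string (beta : nat) (w : seq ('I_beta * 'I_beta)) :
  seq (letter beta) := [seq inl xy | xy <- w].

(* (x_1,y_1)...(x_n,y_n)(z) *)
Definition odd_string (beta : nat) (w : seq ('I_beta * 'I_beta))
  (z : 'I_beta) : seq (letter beta) := rcons (even_string w) (inr z).

(* x_1 ... x_n y_n ... y_1 *)
Definition even_digits (beta : nat) (w : seq ('I_beta * 'I_beta)) : seq nat :=
  [seq val xy.1 | xy <- w] ++ rev [seq val xy.2 | xy <- w].

(* x_1 ... x_n z y_n ... y_1 *)
Definition odd_digits (beta : nat) (w : seq ('I_beta * 'I_beta))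
  (z : 'I_beta) : seq nat :=
  [seq val xy.1 | xy <- w] ++ val z :: rev [seq val xy.2 | xy <- w].

(* Main.v *)
Require Import Defs.
From mathcomp Require Import all_boot.
From mathcomp Require Import zify.

(* A run of the automaton performs the long multiplication of [b] by [a] from
   both ends at once: in state [s_(lambda, rho)], [lambda] is the carry that the
   unread middle block must send to the left and [rho] the carry it receives
   from the right, the middle block of [a * b] being the reverse of that of
   [b]. When [a + b] has no carry, its digits are those of [b] with [a] added to
   the last one, so that accepted strings and reversed pairs coincide. A carry
   in [a + b] is excluded by size except for [a = b = beta - 1]. *)

Set Implicit Arguments.
Unset Strict Implicit.
Unset Printing Implicit Defensive.

(** * Values of digit strings *)

Section OfDigits.

Variable beta : nat.
Implicit Types (d : nat) (u v : seq nat).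

Lemma of_digits_cat u v :
  of_digits beta (u ++ v) = of_digits beta u * beta ^ size v + of_digits beta v.
Proof.
elim/last_ind: v => [|v d IHv]; first by rewrite cats0 muln1 addn0.
rewrite -rcons_cat /of_digits !foldl_rcons -!/(of_digits _ _) IHv size_rcons.
rewrite expnS; lia.
Qed.

Lemma of_digits1 d : of_digits beta [:: d] = d.
Proof. by []. Qed.

Lemma of_digits_cons d u :
  of_digits beta (d :: u) = d * beta ^ size u + of_digits beta u.
Proof. by rewrite -cat1s of_digits_cat. Qed.

Lemma of_digits_rcons u d :
  of_digits beta (rcons u d) = of_digits beta u * beta + d.
Proof. by rewrite -cats1 of_digits_cat expn1. Qed.

Lemma of_digits_lt u :
  all (fun d => d < beta) u -> of_digits beta u < beta ^ size u.
Proof.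
elim: u => // d u IHu /= /andP[d_lt /IHu u_lt].
rewrite of_digits_cons expnS; nia.
Qed.

Lemma of_digits_eq0 u :
  1 < beta -> of_digits beta u = 0 -> u = nseq (size u) 0.
Proof.
move=> beta_gt1; elim: u => // d u IHu.
rewrite of_digits_cons => /eqP; rewrite addn_eq0 muln_eq0 expn_eq0.
by case/andP=> d0 /eqP/IHu {1}->; move: d0; case: eqP => [->|_ /andP[]] //; lia.
Qed.

Lemma of_digits_nseq0 n : of_digits beta (nseq n 0) = 0.
Proof. by elim: n => // n IHn; rewrite /= of_digits_cons IHn. Qed.

End OfDigits.

(** * Long multiplication cut into blocks *)

Section CarryMultiplication.

Variables beta a : nat.
Implicit Types (u v : seq nat) (cin cout : nat).

(* Long multiplication of the digit block [u] by [a], with incoming carry [cin]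
   on the right: it writes the block [v] and sends [cout] to the left. *)
Definition mulc cin u v cout : Prop :=
  a * of_digits beta u + cin = of_digits beta v + cout * beta ^ size u.

(** As [of_digits beta u2 < beta ^ size u2], multiplying by [a] and adding [cin < a] stays below
    [a * beta ^ size u2], so the carry across the cut is again less than [a]. *)
Lemma mulc_cat cin u1 u2 v1 v2 cout :
  all (fun d => d < beta) u2 -> all (fun d => d < beta) v2 ->
  size u2 = size v2 -> cin < a ->
  mulc cin (u1 ++ u2) (v1 ++ v2) cout <->
  exists2 c, c < a & mulc c u1 v1 cout /\ mulc cin u2 v2 c.
Proof.
move=> /of_digits_lt u2_lt /of_digits_lt v2_lt sz cin_lt.
rewrite /mulc !of_digits_cat size_cat expnD -sz in v2_lt *.
set B := beta ^ size u2 in u2_lt v2_lt *.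
set U1 := of_digits _ u1; set V1 := of_digits _ v1.
set U2 := of_digits _ u2 in u2_lt *; set V2 := of_digits _ v2 in v2_lt *.
set C := beta ^ size u1.
split=> [eq12|[c c_lt [eq1 eq2]]]; last by nia.
(* Makes the truncated subtraction in the witness below exact; it follows from [V2 < B]. *)
have le1 : a * U1 <= V1 + cout * C by rewrite -ltnS -(ltn_pmul2r (m := B)); nia.
exists (V1 + cout * C - a * U1); last by split; nia.
rewrite -(ltn_pmul2r (m := B)); nia.
Qed.

(** Cutting after the first digit and before the last yields the two equations of a carry
    transition: [l] leaves the middle block and [r] enters it. *)
Lemma mulc_outer cin x u y x' v y' cout :
  all (fun d => d < beta) (u ++ [:: y]) ->
  all (fun d => d < beta) (v ++ [:: y']) ->
  size u = size v -> cin < a ->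
  mulc cin (x :: u ++ [:: y]) (x' :: v ++ [:: y']) cout <->
  exists l r : 'I_a, [/\ a * x + l = x' + cout * beta, mulc r u v l
    & a * y + cin = y' + r * beta].
Proof.
move=> uy_lt vy_lt sz cin_lt.
have [y_lt y'_lt] : y < beta /\ y' < beta.
  by move: uy_lt vy_lt; rewrite !cats1 !all_rcons => /andP[-> _] /andP[-> _].
have mulc1 d d' c c' : mulc c [:: d] [:: d'] c' <-> a * d + c = d' + c' * beta.
  by rewrite /mulc !of_digits1 expn1.
have split_x := @mulc_cat cin [:: x] _ [:: x'] _ cout uy_lt vy_lt _ cin_lt.
have split_y l : mulc cin (u ++ [:: y]) (v ++ [:: y']) l <->
    exists2 r, r < a & mulc r u v l /\ mulc cin [:: y] [:: y'] r.
  by apply: mulc_cat; rewrite //= ?y_lt ?y'_lt.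
split=> [/split_x[|l l_lt [/mulc1 e1 /split_y[r r_lt [mid /mulc1 e2]]]]|].
- by rewrite !size_cat sz.
- by exists (Ordinal l_lt), (Ordinal r_lt).
case=> l [r [e1 mid e2]]; apply/split_x; first by rewrite !size_cat sz.
exists l => //; split; first exact/mulc1.
by apply/split_y; exists r => //; split=> //; apply/mulc1.
Qed.

End CarryMultiplication.

(** * Runs of the automaton as multiplications *)

Section Runs.

Variables beta a : nat.
Implicit Types (w : seq ('I_beta * 'I_beta)) (o : option 'I_beta).

Definition middle_seq (T : Type) (o : option T) : seq T :=
  if o is Some z then [:: z] else [::].

(* [even_digits] and [odd_digits] at once, according to the middle digit. *)
Definition run_digits w o : seq nat :=
  [seq val xy.1 | xy <- w] ++ [seq val z | z <- middle_seq o]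
    ++ rev [seq val xy.2 | xy <- w].

Definition run_string w o : seq (letter beta) :=
  even_string w ++ [seq inr z | z <- middle_seq o].

(** Letters pair mirror positions, so this reverses the digit string in a form suited to induction
    on [w]. *)
Definition swap_pairs w := [seq (xy.2, xy.1) | xy <- w].

Lemma rev_run_digits w o : rev (run_digits w o) = run_digits (swap_pairs w) o.
Proof.
rewrite /run_digits /swap_pairs !rev_cat revK -!map_comp -catA.
by case: o.
Qed.

Lemma run_digits_cons xy w o :
  run_digits (xy :: w) o = val xy.1 :: run_digits w o ++ [:: val xy.2].
Proof. by rewrite /run_digits /= rev_cons -cats1 -!catA. Qed.

Lemma run_digits_lt w o : all (fun d => d < beta) (run_digits w o).
Proof.
rewrite /run_digits !all_cat all_rev !all_map.
by rewrite !(introT allP) // => xy _ /=; apply: ltn_ord.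
Qed.

Lemma run_digits_cat_lt w o (d : 'I_beta) :
  all (fun d => d < beta) (run_digits w o ++ [:: val d]).
Proof. by rewrite all_cat run_digits_lt /= ltn_ord. Qed.

Lemma size_swap_run_digits w o :
  size (run_digits w o) = size (run_digits (swap_pairs w) o).
Proof. by rewrite -rev_run_digits size_rev. Qed.

Lemma run_digits_surj u :
  all (fun d => d < beta) u -> exists w o, u = run_digits w o.
Proof.
elim: {u}(size u) {-2}u (leqnn (size u)) => [|n IHn] u.
  by case: u => // _ _; exists [::], None.
case: u => [|x u]; first by exists [::], None.
case/lastP: u => [|u y] /=.
  by move=> _; rewrite andbT => x_lt; exists [::], (Some (Ordinal x_lt)).
rewrite size_rcons all_rcons => sz /and3P[x_lt y_lt /IHn[|w [o ->]]].
  exact: ltnW.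
exists ((Ordinal x_lt, Ordinal y_lt) :: w), o.
by rewrite run_digits_cons /= cats1.
Qed.

(** Each letter peels the outer digits of the unread block by [mulc_outer]; on the empty block
    [mulc] reduces to [rho = lambda], the acceptance condition. *)
Lemma accepted_from_carry (lambda rho : 'I_a) w o : a < beta ->
  (exists2 t, t \in dfa_accepting (automaton beta a)
     & labelled_path (M := automaton beta a) (Carry lambda rho)
         (run_string w o) t)
  <-> mulc beta a rho (run_digits w o) (run_digits (swap_pairs w) o) lambda.
Proof.
move=> a_lt; elim: w lambda rho => [|[x y] w IHw] lambda rho.
  case: o => [z|]; last first.
    rewrite /mulc /= muln0 muln1 !add0n; split.
      by case=> t + path_t; rewrite -path_t inE /= => /eqP->.
    by move=> /val_inj->; exists (Carry lambda lambda); rewrite // inE /=.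
  rewrite /mulc /= of_digits1 expn1; split.
    case=> t _ [] [] // /existsP[l /existsP[r /andP[/eqP e1 /eqP e2]]] _.
    have [l_lt rho_lt] := (ltn_ord l, ltn_ord rho).
    rewrite /= in e1 e2 *.
    (* Subtracting gives [l - rho = (lambda - r) * beta], and [|l - rho| < a < beta] forces
       [r = lambda]. *)
    by case: (ltngtP lambda r) => [lt_r|lt_l|eq_r]; nia.
  move=> e; exists (Odd a); first by rewrite inE.
  exists (Odd a) => //; apply/existsP; exists rho; apply/existsP; exists lambda.
  by rewrite /carry_step e !eqxx.
rewrite [swap_pairs _]/= !run_digits_cons [(_, _).1]/= [(_, _).2]/=.
have outer := @mulc_outer beta a rho x _ y y _ x lambda
  (run_digits_cat_lt w o y) (run_digits_cat_lt (swap_pairs w) o x)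
  (size_swap_run_digits w o) (ltn_ord rho).
split=> [[t t_acc] [] [] // l r /andP[/eqP e1 /eqP e2] path_t|].
  by apply/outer; exists l, r; split=> //; apply/IHw; exists t.
move=> /outer[l [r [e1 /IHw[t t_acc path_t] e2]]].
exists t => //; exists (Carry l r) => //=.
by rewrite /carry_step e1 e2 !eqxx.
Qed.

(** The initial transition is [mulc_outer] with zero carry at both ends, the product having outer
    digits [a + b0] and [br]. *)
Lemma accepted_run (br b0 : 'I_beta) w o : 0 < a -> a < beta ->
  accepted (automaton beta a) (run_string ((br, b0) :: w) o) <->
  [/\ 0 < br, a + b0 < beta
    & a * of_digits beta (run_digits ((br, b0) :: w) o)
      = of_digits beta (rev (val br :: rcons (run_digits w o) (a + b0)))].
Proof.
move=> a_gt0 a_lt.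
have mulcE u v :
    a * of_digits beta u = of_digits beta v <-> mulc beta a 0 u v 0.
  by rewrite /mulc !addn0.
rewrite rev_cons rev_rcons rev_run_digits run_digits_cons -cats1 /=.
have outer := @mulc_outer beta a 0 br _ b0 (a + b0) _ br 0
  (run_digits_cat_lt w o b0) (run_digits_cat_lt (swap_pairs w) o br)
  (size_swap_run_digits w o) a_gt0.
split=> [[t t_acc] [] [] // l r|].
  move=> /and5P[br_gt0 b0_gt0 b0_lt /eqP e1 /eqP e2] path_t.
  split=> //; first lia.
  apply/mulcE/outer; exists l, r; split; rewrite ?addn0 // ?mul0n ?addn0 //.
  by apply/accepted_from_carry => //; exists t.
case=> br_gt0 ab0_lt /mulcE/outer[l [r [e1]]].
case/accepted_from_carry=> // t t_acc path_t e2.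
rewrite addn0 in e1 e2.
exists t => //; exists (Carry l r) => //=.
by apply/and5P; split=> //=; lia.
Qed.

End Runs.

(** * Whether [a + b] has more digits than [b] *)

Section Overflow.

Variables beta a b : nat.

(* If the leading digit of [a + b] is created by a carry, then [a + b] has the
   digits 1 0 .. 0 c1 c0 with c1 <= 1, and reversing them gives an explicit
   value for [a * b]. *)
Lemma overflow_pair (s : seq nat) : 1 < beta -> 0 < a -> a <= b ->
  canonical_rep beta (a + b) s -> canonical_rep beta (a * b) (rev s) ->
  b < beta ^ (size s).-1 -> [/\ 2 < beta, a = beta - 1 & b = beta - 1].
Proof.
move=> beta_gt1 a_gt0 le_ab [s_lt s_hd s_val] [_ p_hd p_val] b_lt.
case: s => [|h u] // in s_lt s_hd s_val p_hd p_val b_lt *.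
rewrite /= in s_lt s_hd b_lt.
have /andP[_ u_lt] := s_lt; have {s_lt} /andP[h_lt _] := s_lt.
have ub := of_digits_lt u_lt.
rewrite of_digits_cons in s_val.
have h1 : h = 1 by nia.
rewrite {h}h1 mul1n rev_cons in s_val p_val p_hd {h_lt s_hd}.
have p_lt : a * b < beta ^ (size u).+1.
  have := @of_digits_lt beta (rcons (rev u) 1).
  by rewrite size_rcons size_rev p_val all_rcons beta_gt1 all_rev u_lt; apply.
case/lastP: u => [|u c0] in s_val p_val p_hd u_lt ub b_lt p_lt *.
  by rewrite /= expn0 in b_lt; lia.
case/lastP: u => [|u c1] in s_val p_val p_hd u_lt ub b_lt p_lt *.
  rewrite /= !of_digits1 expn1 /of_digits /= in s_val p_val p_hd b_lt.
  (* Expand, using [a + b = beta + c0] and [a * b = c0 * beta + 1]. *)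
  have /eqP : (beta - a) * (beta - b) = 1 by nia.
  rewrite muln_eq1 => /andP[/eqP a_eq /eqP b_eq].
  by split; nia.
rewrite !rev_rcons !size_rcons /= in s_val p_val b_lt p_lt.
rewrite !of_digits_rcons !of_digits_cons of_digits_rcons in s_val p_val.
rewrite -[size (c1 :: _)]/(size _).+1 !size_rcons size_rev in p_val.
rewrite !all_rcons in u_lt.
have {u_lt ub p_hd} /and3P[c0_lt c1_lt _] := u_lt.
set n := size u in s_val p_val b_lt p_lt.
(* Here [beta ^ n.+2 <= a + b <= 2 * b], while [a * b < beta ^ n.+3]. *)
have a_lt : a < 2 * beta.
  rewrite -(ltn_pmul2r (m := beta ^ n.+2)) ?expn_gt0 1?ltnW //.
  have : a * beta ^ n.+2 <= a * (2 * b) by rewrite leq_mul2l; lia.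
  rewrite expnS in p_lt; nia.
(* As [b < beta ^ n.+2], the part of [a + b] after the leading 1 is below
   [a < 2 * beta <= beta ^ 2]. *)
have u0 : of_digits beta u = 0.
  by case: (of_digits beta u) s_val => // k; nia.
have rev0 : of_digits beta (rev u) = 0.
  by rewrite (of_digits_eq0 beta_gt1 u0) rev_nseq of_digits_nseq0.
rewrite {}u0 {}rev0 !mul0n !add0n in s_val p_val.
have c1_le1 : c1 <= 1 by nia.
set B := beta ^ n.+1 in s_val p_val b_lt.
have B_gt : beta <= B by rewrite /B expnS leq_pmulr ?expn_gt0 1?ltnW.
rewrite !(expnS beta n.+1) -/B in s_val p_val b_lt {p_lt}.
case: c1 c1_le1 {c1_lt} => [|[|//]] _ in s_val p_val.
  (* Eliminating [b] factors the relation; both factors being 1 forces [beta = B = 2] and [c0 = 2],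
     which is not a digit. *)
  have /eqP : (a - c0) * (beta * B - a) = 1 by nia.
  rewrite muln_eq1 => /andP[/eqP a_eq /eqP B_eq].
  have B_le2 : B <= 2 by rewrite -(leq_pmul2l (m := beta)); lia.
  have [beta2 B2] : beta = 2 /\ B = 2 by lia.
  by rewrite B2 beta2 in a_eq B_eq c0_lt; lia.
(* With [c1 = 1], [b < beta * B] gives [a - c0 > beta]; the terms [a * beta] then cancel, leaving
   [beta ^ 2 * B <= B + 1], which is absurd. *)
have c0_lt_a : beta + c0 < a by lia.
have : (a - c0) * (beta * B - a) + a * beta = B + 1 by nia.
have : beta * (beta * B - a) <= (a - c0) * (beta * B - a).
  by rewrite leq_mul2r; lia.
have : 2 * B <= beta * (beta * B) by nia.
by rewrite mulnBr (mulnC a beta); lia.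
Qed.

(** The last digit [c] of [a + b] leads [a * b], which is at least [a * beta ^ (size s).-1]; hence
    [a <= c], and subtracting [a] borrows nothing. *)
Lemma no_overflow_pair (s : seq nat) : 0 < a ->
  canonical_rep beta (a + b) s -> canonical_rep beta (a * b) (rev s) ->
  beta ^ (size s).-1 <= b ->
  a < beta /\
  exists u c, [/\ s = rcons u c, a <= c & b = of_digits beta (rcons u (c - a))].
Proof.
move=> a_gt0 [s_lt s_hd s_val] [p_lt _ p_val] b_ge.
case/lastP: s => [|u c] // in s_lt s_hd s_val p_lt p_val b_ge *.
rewrite size_rcons /= in b_ge.
have le_ab : a * beta ^ size u <= a * b by rewrite leq_mul2l b_ge orbT.
have := of_digits_lt p_lt.
rewrite p_val size_rev size_rcons => /(leq_ltn_trans le_ab).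
rewrite expnS ltn_mul2r => /andP[_ a_lt]; split=> //.
rewrite rev_rcons /= in p_lt p_val.
have /andP[_ /of_digits_lt] := p_lt; rewrite size_rev => rev_lt.
rewrite of_digits_cons size_rev in p_val.
have le_ac : a <= c.
  rewrite -ltnS -(ltn_pmul2r (m := beta ^ size u)); first by lia.
  by case: (posnP beta) rev_lt a_lt => [->|]; rewrite ?expn_gt0; lia.
by exists u, c; split=> //; rewrite !of_digits_rcons in s_val *; lia.
Qed.

End Overflow.

(** * Accepted strings versus reversed pairs *)

Section Pairs.

Variables beta a : nat.

Lemma accepted_reversed_sum_product w (o : option 'I_beta) :
  1 < beta -> 0 < a -> a < beta ->
  accepted (automaton beta a) (run_string w o) ->
  reversed_sum_product beta a (of_digits beta (run_digits w o)).
Proof.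
move=> beta_gt1 a_gt0 a_lt; case: w => [|[br b0] w].
  case: o => [z|] [t t_acc] /=; last by move=> eq_t; rewrite -eq_t inE in t_acc.
  case=> [[||//]] //=; rewrite /run_digits /= of_digits1.
  case/orP=> /and3P[beta_ge /eqP a_eq /eqP z_eq] _.
    split; rewrite ?a_eq ?z_eq //.
    by exists [:: 4], [:: 4]; split=> //; split; rewrite //= beta_ge.
  split; rewrite ?a_eq ?z_eq //; try lia.
  (* These are [2 * (beta - 1)] and [(beta - 1) ^ 2]; [beta >= 3] keeps the digit [beta - 2]
     nonzero. *)
  exists [:: 1; beta - 2], [:: beta - 2; 1].
  by split=> //; split; rewrite /of_digits /=; nia.
move=> /accepted_run[//|//|br_gt0 ab0_lt mul_eq].
rewrite run_digits_cons /= cats1 in mul_eq *.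
have b_ge : beta <= of_digits beta (nat_of_ord br :: rcons (run_digits w o) b0).
  rewrite of_digits_cons size_rcons expnS mulnCA (leq_trans _ (leq_addr _ _)) //.
  by rewrite leq_pmulr // muln_gt0 br_gt0 expn_gt0 ltnW.
split=> //; try lia.
pose s := nat_of_ord br :: rcons (run_digits w o) (a + b0); exists s, (rev s).
split=> //; split.
- by rewrite /= all_rcons ab0_lt ltn_ord run_digits_lt.
- by rewrite /= -lt0n.
- by rewrite /s -!rcons_cons !of_digits_rcons; lia.
- by rewrite all_rev /= all_rcons ab0_lt ltn_ord run_digits_lt.
- by rewrite /s -rcons_cons rev_rcons /=; lia.
- by rewrite mul_eq.
Qed.

Lemma reversed_sum_product_accepted b :
  1 < beta -> reversed_sum_product beta a b ->
  a < beta /\ exists w (o : option 'I_beta),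
    accepted (automaton beta a) (run_string w o) /\
    b = of_digits beta (run_digits w o).
Proof.
move=> beta_gt1 [a_gt0 b_gt0 le_ab [s [p [s_can p_can p_eq]]]].
rewrite {p}p_eq in p_can.
have single (z : 'I_beta) : edge (Init a) (inr z) (Odd a) -> val z = b ->
    exists w (o : option 'I_beta),
    accepted (automaton beta a) (run_string w o) /\
    b = of_digits beta (run_digits w o).
  move=> edge_z z_b; exists [::], (Some z); split; last by rewrite -z_b.
  by exists (Odd a); rewrite ?inE //; exists (Odd a).
case: (ltnP b (beta ^ (size s).-1)) => [b_lt|b_ge].
  have [beta_gt2 a_eq b_eq] :=
    overflow_pair beta_gt1 a_gt0 le_ab s_can p_can b_lt.
  have b_beta : b < beta by lia.
  split; first lia.
  apply: (single (Ordinal b_beta)) => //=.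
  by rewrite beta_gt2 a_eq b_eq !eqxx orbT.
have [a_lt [u [c [s_eq le_ac b_eq]]]] := no_overflow_pair a_gt0 s_can p_can b_ge.
split=> //; case: u => [|h u] in s_eq b_eq.
  have b_beta : b < beta.
    by case: s_can; rewrite s_eq /= andbT b_eq /= of_digits1; lia.
  have [_ _ sum_eq] := s_can; have [_ _ prod_eq] := p_can.
  rewrite s_eq /of_digits /= in sum_eq prod_eq.
  (* A one-digit sum is its own reverse, so [a + b = a * b]. *)
  have /eqP : (a - 1) * (b - 1) = 1 by nia.
  rewrite muln_eq1 => /andP[/eqP a_eq /eqP b1_eq].
  have [a2 b2] : a = 2 /\ b = 2 by lia.
  apply: (single (Ordinal b_beta)) => //=.
  by case: s_can => s_lt; rewrite s_eq /= a2 b2 /= in s_lt sum_eq *; lia.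
rewrite {s}s_eq in s_can p_can b_ge.
have [s_lt s_hd _] := s_can; have [_ _ prod_eq] := p_can.
rewrite /= all_rcons in s_lt s_hd; have /and3P[h_lt c_lt u_lt] := s_lt.
have [w [o u_eq]] := run_digits_surj u_lt.
have ca_lt : c - a < beta by lia.
exists ((Ordinal h_lt, Ordinal ca_lt) :: w), o; split; last first.
  by rewrite b_eq run_digits_cons /= cats1 u_eq.
apply/accepted_run => //=; split; [lia | lia |].
by rewrite run_digits_cons /= cats1 subnKC // -u_eq -b_eq prod_eq.
Qed.

End Pairs.

Theorem theorem1p2 (beta : nat) (hbeta : 2 <= beta) :
  [/\ forall a : nat, 1 <= a -> a < beta ->
        forall w : seq ('I_beta * 'I_beta), 1 <= size w ->
        accepted (automaton beta a) (even_string w) ->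
        reversed_sum_product beta a (of_digits beta (even_digits w)),
      forall a : nat, 1 <= a -> a < beta ->
        forall (w : seq ('I_beta * 'I_beta)) (z : 'I_beta),
        accepted (automaton beta a) (odd_string w z) ->
        reversed_sum_product beta a (of_digits beta (odd_digits w z))
    & forall a b : nat, reversed_sum_product beta a b ->
        a < beta /\
        ((exists w : seq ('I_beta * 'I_beta),
            [/\ 1 <= size w, accepted (automaton beta a) (even_string w)
              & b = of_digits beta (even_digits w)]) \/
         (exists (w : seq ('I_beta * 'I_beta)) (z : 'I_beta),
            accepted (automaton beta a) (odd_string w z) /\
            b = of_digits beta (odd_digits w z)))].
Proof.
split=> [a a_gt0 a_lt w _ w_acc|a a_gt0 a_lt w z w_acc|a b].
- rewrite -[even_digits w]/(run_digits w None).
  by apply: accepted_reversed_sum_product; rewrite // /run_string cats0.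
- rewrite -[odd_digits w z]/(run_digits w (Some z)).
  by apply: accepted_reversed_sum_product; rewrite // /run_string cats1.
case/(reversed_sum_product_accepted hbeta) => a_lt [w [[z|] [w_acc b_eq]]].
  split=> //; right; exists w, z; split=> //.
  by rewrite /run_string cats1 in w_acc.
split=> //; left; exists w; rewrite /run_string cats0 in w_acc; split=> //.
(* The empty string ends at [Init], which is not accepting. *)
by case: w w_acc {b_eq} => // -[t t_acc] /= eq_t; rewrite -eq_t inE in t_acc.
Qed.
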